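(* Let $n\ge 2$ and let $f\colon[0,\infty)\to[0,\infty)$ be moderately increasing and convex. Put $M(x,y)=f(x)f(y)$ and $\rho_M(x,y)=\dfrac{|x-y|}{f(|x|)f(|y|)}$ for $x,y\in\mathbb{R}^n$. Then $\rho_M$ is $c$--quasiconvex in $\mathbb{R}^n$ for some $c\le\sqrt{\pi^2/4+4}$.
   Context: Convention $0/0=0$. A function $f\colon[0,\infty)\to[0,\infty)$ is moderately increasing if it is increasing and $f(t)/t$ is decreasing on $(0,\infty)$. For a path $\gamma\colon[0,l]\to\mathbb{R}^n$, $\ell_M(\gamma)=\lim\sum_i\rho_M(\gamma(t_i),\gamma(t_{i+1}))$, the limit over partitions $0=t_0<\dots<t_m=l$ with mesh tending to $0$. $\rho_M$ is $c$--quasiconvex if $\inf_\gamma\ell_M(\gamma)\le c\,\rho_M(x,y)$ for all $x,y$, the infimum over rectifiable paths joining $x$ and $y$. *)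

(* Defs.v *)
From HB Require Import structures.
From mathcomp Require Import all_boot all_order all_algebra.
From mathcomp Require Import all_classical all_reals all_analysis.
Set Implicit Arguments. Unset Strict Implicit. Unset Printing Implicit Defensive.
Import Order.TTheory GRing.Theory Num.Theory.
Import numFieldNormedType.Exports.
Local Open Scope classical_set_scope.
Local Open Scope ring_scope.

Definition enorm (R : realType) (n : nat) (x : 'rV[R]_n) : R :=
  Num.sqrt (\sum_(i < n) x ord0 i ^+ 2).

Definition increasing_on_nonneg (R : realType) (f : R -> R) : Prop :=
  forall s t, 0 <= s -> s <= t -> f s <= f t.

Definition moderately_increasing (R : realType) (f : R -> R) : Prop :=
  increasing_on_nonneg f /\ (forall s t, 0 < s -> s <= t -> f t / t <= f s / s).

Definition convex_on_nonneg (R : realType) (f : R -> R) : Prop :=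
  forall a b lam, 0 <= a -> 0 <= b -> 0 <= lam -> lam <= 1 ->
    f (lam * a + (1 - lam) * b) <= lam * f a + (1 - lam) * f b.

(* rho_M(x,y) = |x-y| / (f(|x|) f(|y|)), with values in extended reals:
   0/0 = 0 and a/0 = +oo for a > 0. *)
Definition rhoM (R : realType) (n : nat) (f : R -> R) (x y : 'rV[R]_n) : \bar R :=
  if enorm (x - y) == 0 then 0%E
  else if f (enorm x) * f (enorm y) == 0 then +oo%E
  else (enorm (x - y) / (f (enorm x) * f (enorm y)))%:E.

Definition is_partition (R : realType) (l : R) (t : nat -> R) (m : nat) : Prop :=
  t 0%N = 0 /\ t m = l /\ (forall i, (i < m)%N -> t i < t i.+1).

Definition mesh_lt (R : realType) (t : nat -> R) (m : nat) (d : R) : Prop :=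
  forall i, (i < m)%N -> t i.+1 - t i < d.

Definition rectifiable_path (R : realType) (n : nat) (l : R) (g : R -> 'rV[R]_n) : Prop :=
  0 <= l /\ {within `[0, l]%classic, continuous g} /\
  exists B : R, forall t m, is_partition l t m ->
    \sum_(i < m) enorm (g (t i.+1) - g (t i)) <= B.

Definition ellM_is (R : realType) (n : nat) (f : R -> R) (l : R)
    (g : R -> 'rV[R]_n) (L : \bar R) : Prop :=
  forall U, nbhs L U -> exists2 d : R, 0 < d & forall t m,
    is_partition l t m -> mesh_lt t m d ->
    U (\sum_(i < m) rhoM f (g (t i)) (g (t i.+1)))%E.

Definition inf_ellM (R : realType) (n : nat) (f : R -> R) (x y : 'rV[R]_n) : \bar R :=
  ereal_inf [set L | exists (l : R) (g : R -> 'rV[R]_n),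
    [/\ rectifiable_path l g, g 0 = x, g l = y & ellM_is f l g L]].

Definition quasiconvex (R : realType) (n : nat) (f : R -> R) (c : R) : Prop :=
  forall x y : 'rV[R]_n, (inf_ellM f x y <= c%:E * rhoM f x y)%E.

(* Main.v *)
(* Write x = |x| u and y = |y| (cos th u + sin th e) with u, e orthonormal and
   0 <= th <= pi, and join x to y inside the plane of u, e by a radial segment and a
   circular arc of angle th, whose radius is either |x| or |y|. The arc of radius r has
   length r th / f(r)^2; as |x| / f(|x|)^2 and |y| / f(|y|)^2 have geometric mean
   sqrt(|x||y|) / (f(|x|) f(|y|)), the cheaper arc costs at most
   sqrt(|x||y|) th / (f(|x|) f(|y|)). The radial part costs the integral of 1/f^2, at most
   2 ||y|-|x|| / (f(|x|) f(|y|)) since f(r) >= max(f(|x|), r f(|y|)/|y|) for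
   |x| <= r <= |y|. Finally th <= pi sin(th/2),
   |x-y|^2 = (|x|-|y|)^2 + 4 |x||y| sin(th/2)^2, and Cauchy-Schwarz give the constant
   sqrt(pi^2/4 + 4). *)
Require Import Defs.
From mathcomp Require Import all_boot all_order all_algebra.
From mathcomp Require Import all_classical all_reals all_analysis.
From mathcomp Require Import ring lra.
Set Implicit Arguments. Unset Strict Implicit. Unset Printing Implicit Defensive.
Import Order.TTheory GRing.Theory Num.Theory.
Import numFieldNormedType.Exports.
Local Open Scope ring_scope.

(** * Inequalities for the sine *)

Lemma one_sub_cos (R : realType) (x : R) : 1 - cos x = 2 * sin (x / 2) ^+ 2.
Proof.
have {1}-> : x = x / 2 + x / 2 by lra.
rewrite cosD -!expr2 cos2sin2; ring.
Qed.

Lemma sin_mvt (R : realType) (x : R) : 0 < x ->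
  exists2 c, 0 < c < x & sin x = cos c * x.
Proof.
move=> x0; have [|c] := @MVT R sin cos 0 x x0 (fun y _ => is_derive_sin y).
  by apply: continuous_subspaceT => y; exact: continuous_sin.
by rewrite in_itv /= sin0 !subr0 => cx e; exists c.
Qed.

Lemma sin_le_id (R : realType) (x : R) : 0 <= x -> sin x <= x.
Proof.
rewrite le_eqVlt => /predU1P[<-|x0]; first by rewrite sin0.
have [c _ ->] := sin_mvt x0; have := cos_le1 c; nra.
Qed.

(** By oddness x >= 0 suffices; for x > 1 the bound is just sin^2 <= 1. Squares fit the squared
    distances used later. *)
Lemma sin_sqr_le (R : realType) (x : R) : sin x ^+ 2 <= x ^+ 2.
Proof.
wlog x0 : x / 0 <= x => [H|].
  have [|x0] := leP 0 x; first exact: H.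
  by have := H (- x); rewrite sinN !sqrrN; apply; lra.
have := sin_le_id x0; have [x1|x1] := leP x 1.
  have : 0 <= sin x.
    by apply: sin_ge0_pi; rewrite x0 /=; apply: (le_trans x1); have := pi_ge2 R; lra.
  by move=> s0 sx; rewrite ler_pXn2r // nnegrE.
have : sin x ^+ 2 <= 1 by rewrite sin2cos2; have := sqr_ge0 (cos x); lra.
by move=> /le_trans s1 _; apply: s1; apply: exprn_ege1; lra.
Qed.

(** Here sin x = x cos c with 0 < c < x, and 1 - cos c = 2 sin(c/2)^2 <= x^2. The cubic defect is
    what makes a chord approximate its arc well enough. *)
Lemma sin_ge_cubic (R : realType) (x : R) : 0 <= x -> x - x ^+ 3 <= sin x.
Proof.
rewrite le_eqVlt => /predU1P[<-|x0]; first by rewrite sin0 expr0n subrr.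
have [c /andP[c0 cx] ->] := sin_mvt x0.
have := one_sub_cos c; have := sin_sqr_le (c / 2) => s e.
have h : 1 - cos c <= x ^+ 2 by nra.
have : (1 - cos c) * x <= x ^+ 2 * x by rewrite ler_pM2r.
by rewrite -exprSr; lra.
Qed.

(* Both chord slopes of sin, on [0, x] and on [x, pi/2], are values of the
   decreasing function cos, so the first dominates the second. *)
Lemma jordan_sin (R : realType) (x : R) : 0 <= x <= pi / 2 -> 2 * x <= pi * sin x.
Proof.
move=> /andP[]; rewrite le_eqVlt => /predU1P[<-|x0]; first by rewrite sin0; lra.
rewrite le_eqVlt => /predU1P[->|x1]; first by rewrite sin_pihalf; lra.
have [c /andP[c0 cx] sx] := sin_mvt x0.
have [|d] := @MVT R sin cos x (pi / 2) x1 (fun y _ => is_derive_sin y).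
  by apply: continuous_subspaceT => y; exact: continuous_sin.
rewrite in_itv /= sin_pihalf => /andP[xd d1] e.
have p0 := pi_gt0 R.
have : cos d <= cos c by rewrite leNgt ltr_cos ?in_itv /=; lra.
move: sx e; move: (cos c) (cos d) (sin x) => C D S -> e CD.
(* Hence [C] pi / 2 >= 1, and multiplication by 2 x gives the claim. *)
have : 1 - C * x <= C * (pi / 2 - x) by rewrite e; nra.
nra.
Qed.

(** * Polar coordinates in a plane *)

Definition dotv (R : realType) (n : nat) (x y : 'rV[R]_n) : R :=
  \sum_(i < n) x ord0 i * y ord0 i.

Lemma enormE (R : realType) (n : nat) (x : 'rV[R]_n) :
  enorm x = Num.sqrt (dotv x x).
Proof. by congr Num.sqrt; apply: eq_bigr => i _; rewrite expr2. Qed.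

Lemma dotvC (R : realType) (n : nat) (x y : 'rV[R]_n) : dotv x y = dotv y x.
Proof. by apply: eq_bigr => i _; rewrite mulrC. Qed.

Lemma dotvDl (R : realType) (n : nat) (x y z : 'rV[R]_n) :
  dotv (x + y) z = dotv x z + dotv y z.
Proof. by rewrite -big_split; apply: eq_bigr => i _; rewrite !mxE mulrDl. Qed.

Lemma dotvZl (R : realType) (n : nat) (a : R) (x z : 'rV[R]_n) :
  dotv (a *: x) z = a * dotv x z.
Proof. by rewrite mulr_sumr; apply: eq_bigr => i _; rewrite !mxE mulrA. Qed.

Lemma dotvDr (R : realType) (n : nat) (x y z : 'rV[R]_n) :
  dotv z (x + y) = dotv z x + dotv z y.
Proof. by rewrite dotvC dotvDl !(dotvC z). Qed.

Lemma dotvZr (R : realType) (n : nat) (a : R) (x z : 'rV[R]_n) :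
  dotv z (a *: x) = a * dotv z x.
Proof. by rewrite dotvC dotvZl (dotvC z). Qed.

Lemma dotvv_ge0 (R : realType) (n : nat) (x : 'rV[R]_n) : 0 <= dotv x x.
Proof. by apply: sumr_ge0 => i _; rewrite -expr2 sqr_ge0. Qed.

Lemma dotvv_eq0 (R : realType) (n : nat) (x : 'rV[R]_n) : dotv x x = 0 -> x = 0.
Proof.
move=> /eqP; rewrite psumr_eq0; last by move=> i _; rewrite -expr2 sqr_ge0.
move=> /allP h; apply/rowP => i; rewrite mxE.
by have /= := h i (mem_index_enum i); rewrite mulf_eq0 orbb => /eqP.
Qed.

Lemma enorm_sqr (R : realType) (n : nat) (x : 'rV[R]_n) :
  enorm x ^+ 2 = dotv x x.
Proof. by rewrite enormE sqr_sqrtr ?dotvv_ge0. Qed.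

Lemma enorm_ge0 (R : realType) (n : nat) (x : 'rV[R]_n) : 0 <= enorm x.
Proof. exact: sqrtr_ge0. Qed.

Lemma enorm_eq0 (R : realType) (n : nat) (x : 'rV[R]_n) : enorm x = 0 -> x = 0.
Proof. by move=> x0; apply: dotvv_eq0; rewrite -enorm_sqr x0 expr0n. Qed.

Lemma dotv_delta (R : realType) (n : nat) (i : 'I_n) (x : 'rV[R]_n) :
  dotv (delta_mx ord0 i) x = x ord0 i.
Proof.
rewrite /dotv (bigD1 i) //= mxE !eqxx mul1r big1 ?addr0 // => j ji.
by rewrite mxE (negbTE ji) andbF mul0r.
Qed.

Lemma dotv_normalize (R : realType) (n : nat) (x : 'rV[R]_n) : x != 0 ->
  dotv ((enorm x)^-1 *: x) ((enorm x)^-1 *: x) = 1.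
Proof.
move=> x0; have n0 : enorm x != 0.
  by apply: contra x0 => /eqP /enorm_eq0 ->.
by rewrite dotvZl dotvZr -enorm_sqr; field.
Qed.

Lemma exists_unit_direction (R : realType) (n : nat) (x : 'rV[R]_n) :
  (0 < n)%N -> exists2 u, dotv u u = 1 & x = enorm x *: u.
Proof.
case: n x => // n x _; have [->|x0] := eqVneq x 0.
  exists (delta_mx ord0 ord0); first by rewrite dotv_delta mxE !eqxx.
  suff -> : enorm (0 : 'rV[R]_n.+1) = 0 by rewrite scale0r.
  by rewrite /enorm big1 ?sqrtr0 // => i _; rewrite mxE expr0n.
exists ((enorm x)^-1 *: x); first exact: dotv_normalize.
rewrite scalerA divff ?scale1r //.
by apply: contra x0 => /eqP /enorm_eq0 ->.
Qed.

(** The first two coordinates of [u], turned by a right angle, give a vector orthogonal to [u]; this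
    is where dimension two enters. If that vector vanishes, the first basis vector is already
    orthogonal to [u]. *)
Lemma exists_orthogonal_unit (R : realType) (n : nat) (u : 'rV[R]_n) :
  (2 <= n)%N -> exists2 e, dotv e e = 1 & dotv u e = 0.
Proof.
case: n u => [//|[//|n]] u _; pose i0 : 'I_n.+2 := ord0.
pose i1 : 'I_n.+2 := lift ord0 ord0; pose d i : 'rV[R]_n.+2 := delta_mx ord0 i.
pose w := u ord0 i1 *: d i0 + (- u ord0 i0) *: d i1.
have uw : dotv u w = 0.
  by rewrite dotvDr !dotvZr !(dotvC u) !dotv_delta; ring.
have [w0|w0] := eqVneq w 0; last first.
  exists ((enorm w)^-1 *: w); first exact: dotv_normalize.
  by rewrite dotvZr uw mulr0.
exists (d i0); first by rewrite dotv_delta mxE !eqxx.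
rewrite dotvC dotv_delta.
have := congr1 (fun m : 'rV[R]_n.+2 => m ord0 i1) w0.
by rewrite !mxE /= => h; lra.
Qed.

(** Gram-Schmidt: [th] is the arc cosine of the inner product, and the part of [v] orthogonal to [u]
    has length sin th. If that part is zero, so is sin th, and any unit [e] orthogonal to [u] will
    do. *)
Lemma exists_polar_form (R : realType) (n : nat) (u v : 'rV[R]_n) :
  (2 <= n)%N -> dotv u u = 1 -> dotv v v = 1 ->
  exists e th, [/\ dotv e e = 1, dotv u e = 0, 0 <= th <= pi &
    v = cos th *: u + sin th *: e].
Proof.
move=> n2 u1 v1; set c := dotv u v.
(* Cauchy-Schwarz for unit vectors, from |u + v|^2 >= 0 and |u - v|^2 >= 0. *)
have c1 : -1 <= c <= 1.
  have := dotvv_ge0 (u + v); have := dotvv_ge0 (u + (-1) *: v).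
  rewrite !(dotvDl, dotvDr, dotvZl, dotvZr) u1 v1 (dotvC v u) -/c => h1 h2.
  by apply/andP; split; lra.
pose w := v + (- c) *: u.
have ww : dotv w w = 1 - c ^+ 2.
  by rewrite !(dotvDl, dotvDr, dotvZl, dotvZr) u1 v1 (dotvC v u) -/c; ring.
have uw : dotv u w = 0 by rewrite dotvDr dotvZr u1 -/c; ring.
have vE : v = c *: u + w by rewrite addrCA scaleNr subrr addr0.
have th0 : 0 <= acos c <= pi by rewrite acos_ge0 ?acos_lepi.
have cE : cos (acos c) = c by rewrite acosK.
have sE : sin (acos c) = enorm w by rewrite sin_acos // enormE ww.
have [w0|w0] := eqVneq w 0.
  have [e e1 ue] := exists_orthogonal_unit u n2.
  exists e, (acos c); split=> //.
  rewrite cE sE {1}vE w0; congr (_ + _).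
  by rewrite enormE -(scale0r w) dotvZl mul0r sqrtr0 !scale0r.
exists ((enorm w)^-1 *: w), (acos c); split=> //; first exact: dotv_normalize.
  by rewrite dotvZr uw mulr0.
rewrite cE sE scalerA divff ?scale1r //.
by apply: contra w0 => /eqP /enorm_eq0 ->.
Qed.

Definition polar (R : realType) (n : nat) (u e : 'rV[R]_n) (r a : R) : 'rV[R]_n :=
  (r * cos a) *: u + (r * sin a) *: e.

(** The law of cosines in half-angle form. *)
Lemma dist_polar_sqr (R : realType) (n : nat) (u e : 'rV[R]_n) (r a s b : R) :
  dotv u u = 1 -> dotv e e = 1 -> dotv u e = 0 ->
  enorm (polar u e r a - polar u e s b) ^+ 2 =
  (r - s) ^+ 2 + 4 * r * s * sin ((a - b) / 2) ^+ 2.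
Proof.
move=> u1 e1 ue; rewrite enorm_sqr /polar -scaleN1r.
rewrite !(dotvDl, dotvDr, dotvZl, dotvZr) (dotvC e u) u1 e1 ue.
have h : 4 * r * s * sin ((a - b) / 2) ^+ 2 = 2 * r * s * (1 - cos (a - b)).
  by rewrite one_sub_cos; ring.
rewrite h cosB; have := cos2Dsin2 a; have := cos2Dsin2 b.
move: (cos a) (cos b) (sin a) (sin b) => A B C D hB hA.
transitivity (r ^+ 2 * (A ^+ 2 + C ^+ 2) + s ^+ 2 * (B ^+ 2 + D ^+ 2)
  - 2 * r * s * (A * B + C * D)); first by ring.
by rewrite hA hB; ring.
Qed.

Lemma enorm_polar (R : realType) (n : nat) (u e : 'rV[R]_n) (r a : R) :
  dotv u u = 1 -> dotv e e = 1 -> dotv u e = 0 -> 0 <= r ->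
  enorm (polar u e r a) = r.
Proof.
(* The norm is the distance to the point of radius 0, which is the origin. *)
move=> u1 e1 ue r0; have := dist_polar_sqr r a 0 0 u1 e1 ue.
rewrite [polar u e 0 0]/polar !mul0r !scale0r addr0 subr0 => h.
apply/eqP; rewrite -(@eqrXn2 _ 2) ?enorm_ge0 // h; apply/eqP; ring.
Qed.

(** * A primitive of 1/f^2 *)

Lemma lipschitz_continuous (R : realType) (V : normedModType R) (g : R -> V) (K : R) :
  (forall a b, a <= b -> `|g b - g a| <= K * (b - a)) -> continuous g.
Proof.
move=> h x; apply/cvgrPdist_lt => e e0.
have h2 y : `|g x - g y| <= `|K| * `|x - y|.
  have K0 := ler_norm K; case: (leP x y) => xy.
    rewrite distrC (distrC x) (ger0_norm (_ : 0 <= y - x)) ?subr_ge0 //.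
    by apply: (le_trans (h _ _ xy)); rewrite ler_wpM2r ?subr_ge0.
  move/ltW: xy => xy; rewrite (ger0_norm (_ : 0 <= x - y)) ?subr_ge0 //.
  by apply: (le_trans (h _ _ xy)); rewrite ler_wpM2r ?subr_ge0.
near=> y; apply: (le_lt_trans (h2 y)).
have K1 : 0 < `|K| + 1 by rewrite ltr_wpDl.
apply: (@le_lt_trans _ _ ((`|K| + 1) * `|x - y|)).
  by rewrite ler_wpM2r ?lerDl.
rewrite mulrC -ltr_pdivlMr //; near: y.
by apply: (@cvgr_dist_lt _ _ _ (nbhs x) _ id x); rewrite ?divr_gt0.
Unshelve. all: by end_near. Qed.

(** By convexity the slope of f from a to b is at most that from a to a point N > b, hence at most
    f(N) / (N - a). The decrease of f(t)/t gives f(N) <= N f(1), and N = 2b + 2 satisfies N <= 2 (N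
    - a). *)
Lemma moderately_increasing_lipschitz (R : realType) (f : R -> R) :
  (forall t, 0 <= t -> 0 <= f t) -> moderately_increasing f -> convex_on_nonneg f ->
  forall a b, 0 <= a -> a <= b -> f b - f a <= 2 * f 1 * (b - a).
Proof.
move=> f0 [inc dec] cvx a b a0 ab.
pose N := 2 * b + 2; pose lam := (N - b) / (N - a).
have Na : 0 < N - a by rewrite /N; lra.
have lam0 : 0 <= lam by rewrite divr_ge0 // /N; lra.
have lam1 : lam <= 1 by rewrite ler_pdivrMr // mul1r lerD2l lerN2.
have N0 : 0 <= N by rewrite /N; lra.
have := cvx a N lam a0 N0 lam0 lam1.
have -> : lam * a + (1 - lam) * N = b by rewrite /lam; field; lra.
have := dec 1 N ltr01; rewrite divr1 /N => /(_ ltac:(lra)).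
rewrite -/N ler_pdivrMr => [fN|]; last by rewrite /N; lra.
have mu : (1 - lam) * N <= 2 * (b - a).
  have -> : (1 - lam) * N = (b - a) * N / (N - a) by rewrite /lam; field; lra.
  by rewrite ler_pdivrMr // /N; nra.
have f1 : 0 <= f 1 by apply: f0.
have fa := f0 a a0.
have : (1 - lam) * f N <= (1 - lam) * N * f 1.
  by rewrite -mulrA (mulrC N) ler_wpM2l // subr_ge0.
have : (1 - lam) * N * f 1 <= 2 * (b - a) * f 1 by rewrite ler_wpM2r.
have : lam * f a <= f a by rewrite ler_piMl.
by rewrite -(mulrA 2 (f 1)) (mulrC (f 1)) mulrA; lra.
Qed.

Lemma continuous_primitive (R : realType) (h : R -> R) (a : R) : continuous h ->
  exists G : R -> R, forall x, a < x -> is_derive x 1 G (h x).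
Proof.
move=> hc.
pose G y := (\int[lebesgue_measure]_(t in [set` `[a, y]]) h t)%R.
exists G => x ax.
have [] := @continuous_FTC1_closed R h a x (x + 1) _ _ ax (hc x).
- by lra.
- apply: continuous_compact_integrable; first exact: segment_compact.
  exact: continuous_subspaceT.
rewrite -/G derive1E => d e; exact: DeriveDef.
Qed.

(** Since f is controlled only on [0, oo), it is evaluated at max(s0, x): the result is continuous
    on the whole line, at least f(s0) > 0, and unchanged for x >= s0. *)
Lemma inv_sqr_primitive (R : realType) (f : R -> R) (s0 : R) :
  (forall t, 0 <= t -> 0 <= f t) -> moderately_increasing f -> convex_on_nonneg f ->
  0 <= s0 -> 0 < f s0 ->
  exists G : R -> R, forall x, s0 <= x -> is_derive x 1 G ((f x ^+ 2)^-1).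
Proof.
move=> f0 mi cvx s00 fs0.
have Lip := moderately_increasing_lipschitz f0 mi cvx; have [inc _] := mi.
have fc : continuous (fun x => f (Num.max s0 x)).
  apply: (@lipschitz_continuous _ R^o _ (2 * f 1)) => a b ab.
  have le1 : s0 <= Num.max s0 a by rewrite le_max lexx.
  have le2 : Num.max s0 a <= Num.max s0 b.
    by rewrite ge_max !le_max lexx ab orbT.
  rewrite ger0_norm ?subr_ge0; last by apply: inc => //; lra.
  apply: (le_trans (Lip _ _ _ le2)); first by lra.
  apply: ler_wpM2l; first by rewrite mulr_ge0 // f0.
  by rewrite /Num.max; case: ltP => h1; case: ltP => h2; lra.
have hc : continuous (fun x => (f (Num.max s0 x) ^+ 2)^-1).
  move=> x; apply: cvgV.
    apply: lt0r_neq0; apply: exprn_gt0; apply: (lt_le_trans fs0); apply: inc => //.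
    by rewrite le_max lexx.
  by apply: cvgM; exact: fc.
(* Integrating from s0 - 1 makes s0 an interior point, so the two-sided derivative exists there as
   well. *)
have [G hG] := @continuous_primitive R _ (s0 - 1) hc.
exists G => x sx; have := hG x ltac:(lra).
by rewrite max_r.
Qed.

Lemma derive_mvt (R : realType) (G g : R -> R) (x y : R) : x <= y ->
  (forall z, x <= z -> z <= y -> is_derive z 1 G (g z)) ->
  exists2 c, x <= c <= y & G y - G x = g c * (y - x).
Proof.
move=> xy hG; have [| |c] := @MVT_segment R G g x y xy.
- by move=> z; rewrite in_itv /= => /andP[h1 h2]; apply: hG; rewrite ltW.
- apply: derivable_within_continuous => z; rewrite in_itv /= => /andP[h1 h2].
  by have [] := hG z h1 h2.
- by rewrite in_itv /= => h e; exists c.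
Qed.

(** [G] measures radial length. The first bound is a crude one for short segments; the second says
    that a short segment costs its increment of [G] up to a quadratic error, so that sums over
    partitions converge; the third is the cost estimate for a whole segment. *)
Lemma length_primitive (R : realType) (f : R -> R) (s0 : R) :
  (forall t, 0 <= t -> 0 <= f t) -> moderately_increasing f -> convex_on_nonneg f ->
  0 <= s0 -> 0 < f s0 ->
  exists G : R -> R, forall x y, s0 <= x -> x <= y ->
  [/\ 0 <= G y - G x <= (f s0)^-1 ^+ 2 * (y - x),
      `|(y - x) / (f x * f y) - (G y - G x)| <= 4 * f 1 * (f s0)^-1 ^+ 3 * (y - x) ^+ 2
    & G y - G x <= 2 * (y - x) / (f x * f y)].
Proof.
move=> f0 mi cvx s00 fs0; have [G hG] := inv_sqr_primitive f0 mi cvx s00 fs0.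
have Lip := moderately_increasing_lipschitz f0 mi cvx; have [inc dec] := mi.
exists G => x y sx xy.
have x0 : 0 <= x by lra.
have y0 : 0 <= y by lra.
have fx : f s0 <= f x by apply: inc.
have fy : f x <= f y by apply: inc.
have [c /andP[xc cy] GE] : exists2 c, x <= c <= y &
    G y - G x = (f c ^+ 2)^-1 * (y - x).
  by apply: derive_mvt => // z xz _; apply: hG; lra.
have fxc : f x <= f c by apply: inc.
have fcy : f c <= f y by apply: inc => //; lra.
have yx : 0 <= y - x by rewrite subr_ge0.
have A0 : 0 < f x by lra.
have B0 : 0 < f y by lra.
have C0 : 0 < f c by lra.
have hA : (f x)^-1 <= (f s0)^-1 by rewrite lef_pV2 ?posrE.
have hC : (f c)^-1 <= (f x)^-1 by rewrite lef_pV2 ?posrE.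
have hB : (f y)^-1 <= (f c)^-1 by rewrite lef_pV2 ?posrE.
have fB0 : 0 <= (f y)^-1 by rewrite invr_ge0 ltW.
have m0 : 0 <= (f s0)^-1 by rewrite invr_ge0 ltW.
have f1 : 0 <= f 1 by apply: f0.
split.
- rewrite GE -exprVn mulr_ge0 ?sqr_ge0 //= ler_wpM2r // ler_pXn2r ?nnegrE //; lra.
- have -> : (y - x) / (f x * f y) - (G y - G x) =
      ((f x)^-1 * (f y)^-1 - (f c)^-1 ^+ 2) * (y - x).
    by rewrite GE; field; rewrite !gt_eqF.
  rewrite normrM (ger0_norm yx) expr2 mulrA ler_wpM2r //.
  (* The Lipschitz bound on f passes to 1/f because f stays above f(s0). *)
  have AB : (f x)^-1 - (f y)^-1 <= (f s0)^-1 ^+ 2 * (2 * f 1 * (y - x)).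
    have -> : (f x)^-1 - (f y)^-1 = ((f x)^-1 * (f y)^-1) * (f y - f x).
      by field; rewrite !gt_eqF.
    apply: ler_pM; [|lra| |exact: Lip]; first by rewrite mulr_ge0 // invr_ge0 ltW.
    by rewrite expr2; apply: ler_pM => //; lra.
  have -> : 4 * f 1 * (f s0)^-1 ^+ 3 * (y - x) =
      (f s0)^-1 ^+ 2 * (2 * f 1 * (y - x)) * (2 * (f s0)^-1) by ring.
  apply: (@le_trans _ _ (((f x)^-1 - (f y)^-1) * (2 * (f s0)^-1))); last first.
    by apply: ler_wpM2r => //; lra.
  move: hA hC hB fB0 m0; move: (f x)^-1 (f y)^-1 (f c)^-1 (f s0)^-1.
  move=> A B C m hA hC hB hB0 m0.
  (* Both [A * B] and [C ^+ 2] lie between B^2 and A^2, so they differ by at most A^2 - B^2 = (A -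
     B)(A + B), where A + B <= 2m. *)
  have BC2 : B ^+ 2 <= C ^+ 2 by nra.
  have CA2 : C ^+ 2 <= A ^+ 2 by nra.
  have BAB : B ^+ 2 <= A * B by nra.
  have ABA : A * B <= A ^+ 2 by nra.
  apply: (@le_trans _ _ (A ^+ 2 - B ^+ 2)).
    by rewrite ler_norml; apply/andP; split; lra.
  by rewrite subr_sqr; apply: ler_wpM2l; lra.
(* On [x, y] we have f z >= max (f x) (z f(y)/y); the two bounds cross at u. *)
have [xy0|xNy] := eqVneq x y; first by rewrite xy0 !subrr mulr0 mul0r.
have yp : 0 < y by move: xNy; rewrite neq_lt => /orP[|]; lra.
have bx : f y * x <= f x * y.
  have [xe|xn0] := eqVneq 0 x.
    by rewrite -[X in f y * X]xe mulr0 mulr_ge0 // ltW.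
  have xp : 0 < x by rewrite lt_neqAle xn0.
  by have := dec x y xp xy; rewrite ler_pdivrMr // mulrAC ler_pdivlMr.
pose u := f x * y / f y.
have up : 0 < u by rewrite divr_gt0 ?mulr_gt0.
have xu : x <= u by rewrite ler_pdivlMr // mulrC.
have uy : u <= y by rewrite ler_pdivrMr // mulrC ler_wpM2l // ltW.
have G1 : G u - G x <= (f x ^+ 2)^-1 * (u - x).
  have [d /andP[xd du] ->] : exists2 d, x <= d <= u &
      G u - G x = (f d ^+ 2)^-1 * (u - x).
    by apply: derive_mvt => // z xz _; apply: hG; lra.
  have fd : f x <= f d by apply: inc.
  rewrite ler_wpM2r ?subr_ge0 // lef_pV2 ?posrE ?exprn_gt0 //; last lra.
  by rewrite ler_pXn2r ?nnegrE //; lra.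
(* The lower bound z f(y)/y for f(z) gives 1/f(z)^2 <= k/z^2, whose primitive is -k/z. Hence G + k/z
   does not increase from u to y. *)
pose k := y ^+ 2 / f y ^+ 2.
have G2 : (G y + k * y^-1) - (G u + k * u^-1) <= 0.
  have [d /andP[ud dy] ->] : exists2 d, u <= d <= y &
      (G y + k * y^-1) - (G u + k * u^-1) =
      ((f d ^+ 2)^-1 - k * (d ^+ 2)^-1) * (y - u).
    apply: (@derive_mvt _ (fun z => G z + k * z^-1)
      (fun z => (f z ^+ 2)^-1 - k * (z ^+ 2)^-1)) => // z uz zy.
    have Gz := hG z ltac:(lra).
    have zn0 : z != 0 by rewrite gt_eqF //; lra.
    have Vz := is_deriveV zn0 (is_derive_id z (1 : R)).
    have := is_deriveD Gz (is_deriveZ k Vz).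
    move=> H; apply: (is_derive_eq H).
    by rewrite /GRing.scale /= mulr1 mulrN.
  have dp : 0 < d by lra.
  have fd : 0 < f d by apply: (lt_le_trans A0); apply: inc => //; lra.
  apply: mulr_le0_ge0; last by rewrite subr_ge0.
  have h := dec d y dp dy.
  have -> : (f d ^+ 2)^-1 - k * (d ^+ 2)^-1 =
      ((f y / y) ^+ 2 - (f d / d) ^+ 2) / ((f d * (f y / y)) ^+ 2).
    by rewrite /k; field; rewrite !gt_eqF.
  rewrite pmulr_lle0 ?invr_gt0 ?exprn_gt0 ?mulr_gt0 ?invr_gt0 //.
  by rewrite subr_le0 ler_pXn2r ?nnegrE // divr_ge0 // ltW.
have E : (f x ^+ 2)^-1 * (u - x) + (k * u^-1 - k * y^-1) =
    (2 * y * f x * f y - x * f y ^+ 2 - y * f x ^+ 2) / (f x * f y) ^+ 2.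
  by rewrite /k /u; field; rewrite !gt_eqF.
have E2 : 2 * (y - x) / (f x * f y) =
    (2 * (y - x) * (f x * f y)) / (f x * f y) ^+ 2.
  by field; rewrite !gt_eqF.
apply: (@le_trans _ _ ((f x ^+ 2)^-1 * (u - x) + (k * u^-1 - k * y^-1))); first lra.
rewrite E E2 ler_pM2r ?invr_gt0 ?exprn_gt0 ?mulr_gt0 //.
(* The two numerators differ by x (f(y) - f(x))^2 + (y - x) f(x)^2. *)
have := mulr_ge0 x0 (sqr_ge0 (f y - f x)).
have : 0 <= (y - x) * f x ^+ 2 by rewrite mulr_ge0 ?sqr_ge0.
lra.
Qed.

(** * Length of a path *)

Lemma partition_le (R : realType) (l : R) (t : nat -> R) (m : nat) :
  is_partition l t m -> forall i j, (i <= j <= m)%N -> t i <= t j.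
Proof.
move=> [_ [_ inc]] i; elim=> [|j IH] /andP[ij jm].
  by move: ij; rewrite leqn0 => /eqP ->.
move: ij; rewrite leq_eqVlt => /predU1P[-> //|ij].
by apply: (le_trans (IH _)); [rewrite -ltnS ij ltnW|rewrite ltW // inc].
Qed.

Lemma partition_bounds (R : realType) (l : R) (t : nat -> R) (m : nat) :
  is_partition l t m -> forall i, (i <= m)%N -> 0 <= t i <= l.
Proof.
move=> pt i im; have [t0 [tm _]] := pt; rewrite -t0 -tm.
by rewrite !(partition_le pt) ?im ?leqnn.
Qed.

Lemma partition_telescope (R : realType) (l : R) (t : nat -> R) (m : nat) (F : R -> R) :
  is_partition l t m -> \sum_(i < m) (F (t i.+1) - F (t i)) = F l - F 0.
Proof.
move=> [t0 [tm _]].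
by rewrite -(big_mkord xpredT (fun i => F (t i.+1) - F (t i))) telescope_sumr // t0 tm.
Qed.

Lemma rectifiable_of_lipschitz (R : realType) (n : nat) (l K : R) (g : R -> 'rV[R]_n) :
  0 <= l -> continuous g ->
  (forall a b : R, 0 <= a -> a <= b -> b <= l -> enorm (g b - g a) <= K * (b - a)) ->
  rectifiable_path l g.
Proof.
move=> l0 cg h; split=> //; split; first exact: continuous_subspaceT.
exists (K * l) => t m pt.
have -> : K * l = K * l - K * 0 by rewrite mulr0 subr0.
rewrite -(partition_telescope (fun s => K * s) pt); apply: ler_sum => i _.
have im := ltn_ord i; have /andP[ti _] := partition_bounds pt (ltnW im).
have /andP[_ tl] := partition_bounds pt im.
by rewrite -mulrBr; apply: h => //; apply: (partition_le pt); rewrite leqnSn im.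
Qed.

(* A partition interval straddling the corner p contributes an error C d only once;
   it is charged to the jump at p of the function phi in the proof. *)
Lemma ellM_is_of_increments (R : realType) (n : nat) (f : R -> R) (l p C : R)
    (g : R -> 'rV[R]_n) (w : R -> R -> R) (F : R -> R) :
  0 <= l -> 0 <= C ->
  (forall a b : R, 0 <= a -> a <= b -> b <= l ->
    [/\ rhoM f (g a) (g b) = (w a b)%:E,
        `|w a b - (F b - F a)| <= C * (b - a)
      & b <= p \/ p <= a -> `|w a b - (F b - F a)| <= C * (b - a) ^+ 2]) ->
  ellM_is f l g (F l - F 0)%:E.
Proof.
move=> l0 C0 h U nU.
have : nbhs (F l - F 0) (fun r : R => U r%:E) by exact: nU.
move=> /nbhs_ballP[e /= e0 he].
have Q0 : 0 < C * (l + 1) + 1 by rewrite ltr_wpDl // mulr_ge0 // addr_ge0.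
(* The total error is at most C d (l + 1): the intervals add up to l and the corner contributes at
   most 1. The last 1 keeps the denominator positive when C = 0. *)
exists (e / (C * (l + 1) + 1)); first by rewrite divr_gt0.
set d := _ / _; move=> t m pt mt.
have d0 : 0 < d by rewrite divr_gt0.
have step (i : 'I_m) : [/\ 0 <= t i, t i < t i.+1, t i.+1 <= l & t i.+1 - t i < d].
  have im := ltn_ord i; have /andP[ti _] := partition_bounds pt (ltnW im).
  have /andP[_ tl] := partition_bounds pt im.
  by split=> //; [have [_ [_]] := pt; apply|exact: mt].
have -> : (\sum_(i < m) rhoM f (g (t i)) (g (t i.+1)))%E =
    (\sum_(i < m) w (t i) (t i.+1))%:E.
  rewrite -sumEFin; apply: eq_bigr => i _; have [ti tt tl _] := step i.
  by have [] := h _ _ ti (ltW tt) tl.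
apply: he; rewrite /ball /= distrC.
rewrite -(partition_telescope F pt) -sumrB.
apply: (le_lt_trans (ler_norm_sum _ _ _)).
pose phi (s : R) := C * d * (s + (p < s)%R%:R).
apply: (@le_lt_trans _ _ (\sum_(i < m) (phi (t i.+1) - phi (t i)))).
  apply: ler_sum => i _; have [ti tt tl td] := step i.
  have [_ h1 h2] := h _ _ ti (ltW tt) tl.
  move: (t i) (t i.+1) ti tt tl td h1 h2 => a b a0 ab bl bd h1 h2.
  have Cd0 : 0 <= C * d by rewrite mulr_ge0 // ltW.
  have E : phi b - phi a = C * d * (b - a) + C * d * ((p < b)%R%:R - (p < a)%R%:R).
    by rewrite /phi; ring.
  (* On one side of [p] the error C (b - a)^2 is at most C d (b - a). If a < p < b, the error C (b -
     a) is at most C d, which the jump of [phi] pays. *)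
  have [st|[pa pb]] : (b <= p \/ p <= a) \/ (a < p /\ p < b).
    by case: (leP b p) => bp; [left; left|case: (leP p a) => pa; [left; right|right]].
    apply: (le_trans (h2 st)); rewrite E ler_wpDr //.
      apply: mulr_ge0 => //; rewrite subr_ge0 ler_nat.
      by case: (ltP p a) => // pa; rewrite (lt_trans pa ab).
    rewrite expr2 mulrA; apply: ler_wpM2r; first by rewrite subr_ge0 ltW.
    by apply: ler_wpM2l => //; exact: ltW.
  apply: (le_trans h1); rewrite E pb (le_gtF (ltW pa)) subr0 mulr1.
  apply: ler_wpDl; first by rewrite mulr_ge0 ?subr_ge0 // ltW.
  by apply: ler_wpM2l => //; exact: ltW.
rewrite (partition_telescope phi pt) /phi.
apply: (@le_lt_trans _ _ (C * d * (l + 1))).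
  have Cd0 : 0 <= C * d by rewrite mulr_ge0 // ltW.
  rewrite -mulrBr; apply: ler_wpM2l => //.
  have : (p < l)%R%:R <= (1 : R) by case: (p < l).
  have : 0 <= ((p < 0)%R%:R : R) by case: (p < 0)%R.
  lra.
have -> : C * d * (l + 1) = e * ((C * (l + 1)) / (C * (l + 1) + 1)) by rewrite /d; ring.
by rewrite gtr_pMr // ltr_pdivrMr // mul1r ltrDl.
Qed.

(** The length up to time t is, up to a constant, [F] = r0 / f(r0)^2 al + sg G(r): the first term
    measures the arc and the second the radial part, [sg] being the direction of radial motion, so
    that length also grows when the radius shrinks. On either side of [p] only one coordinate
    moves. *)
Lemma polar_path_length (R : realType) (n : nat) (f r al G : R -> R)
    (u e : 'rV[R]_n) (m l p r0 sg rho K : R) :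
  dotv u u = 1 -> dotv e e = 1 -> dotv u e = 0 ->
  0 < m -> 0 <= l -> 0 <= K -> 0 <= r0 -> sg = 1 \/ sg = -1 ->
  (forall a b : R, a <= b -> `|r b - r a| <= b - a) ->
  (forall a b : R, a <= b -> 0 <= al b - al a <= b - a) ->
  (forall a, 0 <= a -> a <= l -> [/\ 0 <= r a, r a <= rho & m <= f (r a)]) ->
  (forall a b : R, a <= b -> 0 <= sg * (r b - r a)) ->
  (forall a b : R, 0 <= a -> a <= b -> b <= l -> b <= p \/ p <= a ->
    [/\ r a = r0, r b = r0 & al b - al a = b - a] \/ al a = al b) ->
  (forall a b : R, 0 <= a -> a <= l -> 0 <= b -> b <= l -> r a <= r b ->
    0 <= G (r b) - G (r a) <= m^-1 ^+ 2 * (r b - r a) /\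
    `|(r b - r a) / (f (r a) * f (r b)) - (G (r b) - G (r a))| <=
      K * (r b - r a) ^+ 2) ->
  let g t := polar u e (r t) (al t) in
  rectifiable_path l g /\
  ellM_is f l g (r0 / f r0 ^+ 2 * (al l - al 0) + sg * (G (r l) - G (r 0)))%:E.
Proof.
move=> u1 e1 ue m0 l0 K0 r00 sgE rL alL rB sgr corner GB g.
have rho0 : 0 <= rho by have [h1 h2 _] := rB 0 (lexx 0) l0; lra.
have dist2 a b : enorm (g a - g b) ^+ 2 =
    (r a - r b) ^+ 2 + 4 * r a * r b * sin ((al a - al b) / 2) ^+ 2.
  exact: dist_polar_sqr.
have distC a b : enorm (g a - g b) = enorm (g b - g a).
  apply/eqP; rewrite -(@eqrXn2 _ 2) ?enorm_ge0 // !dist2.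
  by rewrite -(opprB (al b)) mulNr sinN; apply/eqP; ring.
(* The squared distance is at most (1 + rho^2) (b - a)^2, and 1 + rho^2 <= (1 + rho)^2. *)
have gL a b : 0 <= a -> a <= b -> b <= l -> enorm (g a - g b) <= (1 + rho) * (b - a).
  move=> a0 ab bl; have ba : 0 <= b - a by rewrite subr_ge0.
  rewrite -(@ler_pXn2r _ 2) ?nnegrE ?enorm_ge0 //; last by rewrite mulr_ge0 // addr_ge0.
  rewrite dist2 exprMn.
  have [ra0 ra1 _] := rB a a0 ltac:(lra).
  have [rb0 rb1 _] := rB b ltac:(lra) bl.
  have h1 : (r a - r b) ^+ 2 <= (b - a) ^+ 2.
    by rewrite -real_normK ?num_real // distrC ler_pXn2r ?nnegrE ?normr_ge0 ?rL.
  have h2 : 4 * sin ((al a - al b) / 2) ^+ 2 <= (b - a) ^+ 2.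
    have h3 := sin_sqr_le ((al a - al b) / 2).
    have /andP[h4 h5] := alL a b ab.
    have : (al b - al a) ^+ 2 <= (b - a) ^+ 2 by rewrite ler_pXn2r ?nnegrE.
    move: h3; rewrite expr_div_n -[(al a - al b)]opprB sqrrN; lra.
  have h3 : r a * r b <= rho ^+ 2 by rewrite expr2 ler_pM.
  have h4 : r a * r b * (4 * sin ((al a - al b) / 2) ^+ 2) <= rho ^+ 2 * (b - a) ^+ 2.
    apply: ler_pM => //; first exact: mulr_ge0.
    by apply: mulr_ge0; rewrite ?sqr_ge0 ?ler0n.
  have h5 : 0 <= rho * (b - a) ^+ 2 by apply: mulr_ge0; rewrite ?sqr_ge0.
  lra.
split.
  apply: (@rectifiable_of_lipschitz _ _ _ (1 + rho)) => //; last first.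
    by move=> a b a0 ab bl; rewrite -distC; exact: gL.
  have cr : continuous r.
    by apply: (@lipschitz_continuous _ R^o _ 1) => a b; rewrite mul1r; exact: rL.
  have ca : continuous al.
    apply: (@lipschitz_continuous _ R^o _ 1) => a b ab; rewrite mul1r.
    by have /andP[h1 h2] := alL a b ab; rewrite ger0_norm.
  have cc : continuous (fun t => cos (al t)).
    by move=> t; apply: continuous_comp; [exact: ca|exact: continuous_cos].
  have cs : continuous (fun t => sin (al t)).
    by move=> t; apply: continuous_comp; [exact: ca|exact: continuous_sin].
  move=> t; apply: cvgD; apply: cvgZr_tmp; apply: cvgM;
    by [exact: cr|exact: cc|exact: cs].
pose F t := r0 / f r0 ^+ 2 * al t + sg * G (r t).
pose w a b := enorm (g a - g b) / (f (r a) * f (r b)).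
pose c0 := r0 / f r0 ^+ 2.
have c00 : 0 <= c0 by rewrite divr_ge0 ?sqr_ge0.
have mi0 : 0 <= m^-1 by rewrite invr_ge0 ltW.
(* The first two summands give the linear bound across the corner, from the sizes of [w] and of the
   increment of [F]. The third bounds the quadratic error on the arc, and [K] that on the radial
   part. *)
pose C := m^-1 ^+ 2 * (1 + rho) + (c0 + m^-1 ^+ 2) + c0 * l + K.
have C1 : 0 <= m^-1 ^+ 2 * (1 + rho) by rewrite mulr_ge0 ?sqr_ge0 // addr_ge0.
have C2 : 0 <= c0 + m^-1 ^+ 2 by rewrite addr_ge0 ?sqr_ge0.
have C3 : 0 <= c0 * l by rewrite mulr_ge0.
have -> : r0 / f r0 ^+ 2 * (al l - al 0) + sg * (G (r l) - G (r 0)) = F l - F 0.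
  by rewrite /F; ring.
apply: (@ellM_is_of_increments _ _ _ _ p C _ w F) => //; first by rewrite /C; lra.
move=> a b a0 ab bl.
have ba : 0 <= b - a by rewrite subr_ge0.
have al' : a <= l by lra.
have b0 : 0 <= b by lra.
have [ra0 _ ma] := rB a a0 al'; have [rb0 _ mb] := rB b b0 bl.
have fa : 0 < f (r a) by lra.
have fb : 0 < f (r b) by lra.
have /andP[da0 da1] := alL a b ab.
have dr := rL a b ab.
have ff : (f (r a) * f (r b))^-1 <= m^-1 ^+ 2.
  by rewrite exprVn lef_pV2 ?posrE ?mulr_gt0 ?exprn_gt0 // expr2 ler_pM // ltW.
have FE : F b - F a = c0 * (al b - al a) + sg * (G (r b) - G (r a)).
  by rewrite /F /c0; ring.
have GE : `|sg * (r b - r a) / (f (r a) * f (r b)) - sg * (G (r b) - G (r a))|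
      <= K * (r b - r a) ^+ 2 /\
    0 <= sg * (G (r b) - G (r a)) <= m^-1 ^+ 2 * (b - a).
  have s0 := sgr a b ab; move: dr; rewrite ler_norml => /andP[dr1 dr2].
  have m2 : 0 <= m^-1 ^+ 2 by rewrite sqr_ge0.
  case: sgE s0 => ->; rewrite ?mul1r ?mulN1r => s0.
    have [/andP[g1 g2] g3] := GB a b a0 al' b0 bl ltac:(lra).
    split=> //; rewrite g1 /=; apply: (le_trans g2); exact: ler_wpM2l.
  (* For inward motion the bounds on [G] apply with the endpoints exchanged. *)
  have [/andP[g1 g2] g3] := GB b a b0 bl a0 al' ltac:(lra).
  rewrite -[(r b - r a) ^+ 2]sqrrN (opprB (r b)) (opprB (G (r b))) [f (r a) * _]mulrC; split=> //.
  by rewrite g1 /=; apply: (le_trans g2); apply: ler_wpM2l => //; lra.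
have [GE1 /andP[GE2 GE3]] := GE.
split.
- rewrite /rhoM /w !enorm_polar //.
  have [/eqP -> //|_] := ifP; first by rewrite mul0r.
  by rewrite gt_eqF // mulr_gt0.
- rewrite FE.
  have w0 : 0 <= w a b by rewrite divr_ge0 ?enorm_ge0 // mulr_ge0 // ltW.
  have w1 : w a b <= m^-1 ^+ 2 * (1 + rho) * (b - a).
    rewrite -mulrA [leRHS]mulrC; apply: ler_pM; [exact: enorm_ge0| |exact: gL|exact: ff].
    by rewrite invr_ge0 mulr_ge0 // ltW.
  have c1 : c0 * (al b - al a) <= c0 * (b - a) by rewrite ler_wpM2l.
  have c2 : 0 <= c0 * (al b - al a) by rewrite mulr_ge0.
  have C4 : 0 <= (c0 * l + K) * (b - a) by rewrite mulr_ge0 // addr_ge0.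
  rewrite /C ler_norml; apply/andP; split; lra.
move=> st; rewrite FE.
have bal : b - a <= l by lra.
have mon (x y : R) : 0 <= x -> x <= C -> y <= x * (b - a) ^+ 2 -> y <= C * (b - a) ^+ 2.
  by move=> x0 xC /le_trans -> //; rewrite ler_wpM2r ?sqr_ge0.
case: (corner a b a0 ab bl st) => [[rae rbe ale]|ale].
  (* On the arc the chord is 2 r0 |sin((b - a)/2)|. Its defect against r0 (b - a) is cubic, and one
     factor b - a is absorbed by l. *)
  apply: (mon (c0 * l)) => //; first by rewrite /C; lra.
  rewrite rae rbe subrr mulr0 addr0 ale.
  have y0 : 0 <= (b - a) / 2 by rewrite divr_ge0.
  have dE : enorm (g a - g b) = 2 * r0 * `|sin ((b - a) / 2)|.
    apply/eqP; rewrite -(@eqrXn2 _ 2) ?enorm_ge0 ?mulr_ge0 // dist2 rae rbe.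
    rewrite -[al a - al b]opprB ale mulNr sinN sqrrN subrr expr0n /= exprMn.
    by rewrite real_normK ?num_real //; apply/eqP; ring.
  have -> : w a b - c0 * (b - a) = c0 * (2 * `|sin ((b - a) / 2)| - (b - a)).
    by rewrite /w dE rae rbe /c0 -expr2; ring.
  rewrite normrM (ger0_norm c00) -mulrA; apply: ler_wpM2l => //.
  have s1 : `|sin ((b - a) / 2)| <= (b - a) / 2.
    have := sin_sqr_le ((b - a) / 2).
    by rewrite -real_normK ?num_real // ler_pXn2r ?nnegrE.
  have s2 := sin_ge_cubic y0; have s3 := ler_norm (sin ((b - a) / 2)).
  have cub : (b - a) * (b - a) ^+ 2 <= l * (b - a) ^+ 2.
    by rewrite ler_wpM2r ?sqr_ge0.
  have e3 : ((b - a) / 2) ^+ 3 = (b - a) * (b - a) ^+ 2 / 8 by field.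
  have cub0 : 0 <= (b - a) * (b - a) ^+ 2 by apply: mulr_ge0; rewrite ?sqr_ge0.
  rewrite ler_norml; apply/andP; split; lra.
(* With the angle fixed, the distance is exactly |r b - r a|, and the error is that of [G]. *)
apply: (mon K) => //; first by rewrite /C; lra.
rewrite ale subrr mulr0 add0r.
have dE : enorm (g a - g b) = sg * (r b - r a).
  apply/eqP; rewrite -(@eqrXn2 _ 2) ?enorm_ge0 ?sgr // dist2 ale subrr mul0r sin0.
  by case: sgE => ->; apply/eqP; ring.
rewrite /w dE; apply: (le_trans GE1); apply: ler_wpM2l => //.
by rewrite -real_normK ?num_real // ler_pXn2r ?nnegrE ?normr_ge0.
Qed.

(** * Radial segments and circular arcs *)

(** A clock running at unit speed for time [d] from time [c] on. One clock for the radius and one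
    for the angle express the two-piece path by a single formula. *)
Definition ramp (R : realType) (c d t : R) : R := Num.min (Num.max (t - c) 0) d.

Lemma ramp_increment (R : realType) (c d a b : R) : a <= b ->
  0 <= ramp c d b - ramp c d a <= b - a.
Proof.
rewrite /ramp /Num.min /Num.max => ab.
apply/andP; case: (ltP (a - c) 0) => ?; case: (ltP (b - c) 0) => ?;
  by case: ltP => ?; case: ltP => ?; split; lra.
Qed.

Lemma ramp_bounds (R : realType) (c d t : R) : 0 <= d -> 0 <= ramp c d t <= d.
Proof.
by rewrite /ramp => d0; rewrite ge_min le_min le_max !lexx !orbT d0.
Qed.

Lemma ramp_lo (R : realType) (c d t : R) : 0 <= d -> t <= c -> ramp c d t = 0.
Proof. by move=> d0 tc; rewrite /ramp max_r ?subr_le0 // min_l. Qed.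

Lemma ramp_mid (R : realType) (c d t : R) : c <= t <= c + d -> ramp c d t = t - c.
Proof.
by move=> /andP[ct tcd]; rewrite /ramp max_l ?subr_ge0 // min_l // lerBlDl.
Qed.

Lemma ramp_hi (R : realType) (c d t : R) : 0 <= d -> c + d <= t -> ramp c d t = d.
Proof.
move=> d0 h; rewrite /ramp max_l ?subr_ge0; last by lra.
by rewrite min_r // lerBrDl.
Qed.

(* The path consists of a radial segment and a circular arc of radius r0; they are
   traversed on [c, c + |t - s|] and on [a, a + th]. *)
Lemma radial_arc_path (R : realType) (n : nat) (f G : R -> R)
    (u e : 'rV[R]_n) (m K s t th r0 a c p : R) :
  dotv u u = 1 -> dotv e e = 1 -> dotv u e = 0 ->
  0 < m -> 0 <= K -> 0 <= s -> 0 <= t -> 0 <= th ->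
  (forall x, Num.min s t <= x -> m <= f x) ->
  (forall x y, Num.min s t <= x -> x <= y ->
    0 <= G y - G x <= m^-1 ^+ 2 * (y - x) /\
    `|(y - x) / (f x * f y) - (G y - G x)| <= K * (y - x) ^+ 2) ->
  [/\ a = 0, c = th, r0 = s & p = th] \/ [/\ a = `|t - s|, c = 0, r0 = t & p = `|t - s|] ->
  exists l g, [/\ rectifiable_path l g, g 0 = polar u e s 0, g l = polar u e t th &
    ellM_is f l g (r0 / f r0 ^+ 2 * th + `|G t - G s|)%:E].
Proof.
move=> u1 e1 ue m0 K0 s0 t0 th0 fm GB ac.
pose sg : R := if s <= t then 1 else -1; pose d := `|t - s|.
have sgd : sg * d = t - s.
  rewrite /sg /d; case: leP => st; first by rewrite mul1r ger0_norm // subr_ge0.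
  by rewrite ltr0_norm ?subr_lt0 // mulN1r opprK.
have sgE : sg = 1 \/ sg = -1 by rewrite /sg; case: ifP => _; [left|right].
have sgG : `|G t - G s| = sg * (G t - G s).
  rewrite /sg; case: leP => st.
    have [] := GB s t _ st; first by rewrite ge_min lexx.
    by move=> /andP[h _] _; rewrite ger0_norm // mul1r.
  have [] := GB t s _ (ltW st); first by rewrite ge_min lexx orbT.
  by move=> /andP[h _] _; rewrite distrC ger0_norm // mulN1r opprB.
have d0 : 0 <= d by exact: normr_ge0.
have rho0 : 0 <= Num.max s t by rewrite le_max s0.
pose r x := s + sg * ramp c d x; pose al x := ramp a th x; pose l := th + d.
have l0 : 0 <= l by rewrite addr_ge0.
have r00 : 0 <= r0 by case: ac => -[_ _ -> _].
have rB x : Num.min s t <= r x <= Num.max s t.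
  have /andP[h1 h2] := ramp_bounds c x d0; rewrite /r.
  have sgx : sg = 1 /\ s <= t \/ sg = -1 /\ t <= s.
    by rewrite /sg; case: leP => st; [left|right; rewrite ltW].
  case: sgx sgd => -[-> st]; rewrite ?mul1r ?mulN1r => de.
    by rewrite min_l // max_r //; apply/andP; split; lra.
  by rewrite min_r // max_l //; apply/andP; split; lra.
have st0 : 0 <= Num.min s t by rewrite le_min s0.
have ends : [/\ r 0 = s, r l = t, al 0 = 0 & al l = th].
  case: ac => -[ae ce _ _]; rewrite /r /al ae ce; split.
  - by rewrite ramp_lo // mulr0 addr0.
  - by rewrite ramp_hi // sgd addrC subrK.
  - by rewrite ramp_lo.
  - by rewrite ramp_hi // /l add0r lerDl.
  - by rewrite ramp_lo // mulr0 addr0.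
  - by rewrite ramp_hi ?add0r ?lerDr // sgd addrC subrK.
  - by rewrite ramp_lo.
  - by rewrite ramp_hi // /l addrC.
have [r_0 r_l al_0 al_l] := ends.
have [| | | |x y x0 xy yl|x y x0 xl y0 yl rxy|H1 H2] := @polar_path_length R n f r al G u e m l p r0
    sg (Num.max s t) K u1 e1 ue m0 l0 K0 r00 sgE.
- move=> x y xy; have /andP[h1 h2] := ramp_increment c d xy.
  have -> : r y - r x = sg * (ramp c d y - ramp c d x) by rewrite /r; ring.
  by rewrite normrM; case: sgE => ->; rewrite ?normrN normr1 mul1r ger0_norm.
- by move=> x y xy; exact: ramp_increment.
- move=> x x0 xl; have /andP[h1 h2] := rB x.
  by split=> //; [exact: (le_trans st0)|exact: fm].
- move=> x y xy; have /andP[h1 h2] := ramp_increment c d xy.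
  have -> : sg * (r y - r x) = sg ^+ 2 * (ramp c d y - ramp c d x) by rewrite /r; ring.
  by rewrite mulr_ge0 // sqr_ge0.
(* The corner is passed at time [p]. If the arc comes first, the radius is s up to [p] and the angle
   stays th afterwards; if the segment comes first, the angle is 0 up to [p] and the radius stays t
   afterwards. *)
- case: ac => -[ae ce re pe]; rewrite pe /r /al ae ce re => -[yp|px].
  + left; rewrite !(@ramp_lo _ th) ?(le_trans xy) // mulr0 addr0; split=> //.
    by rewrite !ramp_mid; [ring|apply/andP; split; lra|apply/andP; split; lra].
  + by right; rewrite !ramp_hi ?add0r // (le_trans px).
  + by right; rewrite !ramp_lo // (le_trans xy).
  + left; have hi z : `|t - s| <= z -> ramp 0 d z = d by move=> dz; rewrite ramp_hi ?add0r.
    rewrite !hi ?(le_trans px) // sgd addrC subrK; split=> //.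
    move: yl; rewrite /l /d => yl.
    by rewrite !ramp_mid; [ring|apply/andP; split; lra|apply/andP; split; lra].
- by apply: GB => //; have /andP[] := rB x.
exists l, (fun x => polar u e (r x) (al x)).
split; [exact: H1|by rewrite r_0 al_0|by rewrite r_l al_l|].
suff -> : r0 / f r0 ^+ 2 * th + `|G t - G s| =
    r0 / f r0 ^+ 2 * (al l - al 0) + sg * (G (r l) - G (r 0)) by exact: H2.
by rewrite r_0 r_l al_0 al_l subr0 sgG.
Qed.

(** * Choice of the cheaper path and the constant *)

(** Here [p] and [q] stand for f(s) and f(t), [v] for the radial cost and [D] for |x - y|; the
    disjunction chooses the radius of the arc. *)
Lemma radial_arc_cost (R : realType) (s t th p q v D : R) :
  0 <= s -> 0 <= t -> 0 <= th <= pi -> 0 < p -> 0 < q -> 0 <= D ->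
  D ^+ 2 = (s - t) ^+ 2 + 4 * s * t * sin (th / 2) ^+ 2 ->
  v <= 2 * `|t - s| / (p * q) ->
  s / p ^+ 2 * th + v <= Num.sqrt (pi ^+ 2 / 4 + 4) * (D / (p * q)) \/
  t / q ^+ 2 * th + v <= Num.sqrt (pi ^+ 2 / 4 + 4) * (D / (p * q)).
Proof.
move=> s0 t0 /andP[th0 thpi] p0 q0 D0 DE hv.
have pq : 0 < p * q by exact: mulr_gt0.
pose S := Num.sqrt (s * t).
have S0 : 0 <= S by exact: sqrtr_ge0.
have SE : S ^+ 2 = s * t by rewrite sqr_sqrtr ?mulr_ge0.
have J := @jordan_sin R (th / 2) ltac:(apply/andP; split; lra).
have n0 := normr_ge0 (t - s).
have key : S * th + 2 * `|t - s| <= Num.sqrt (pi ^+ 2 / 4 + 4) * D.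
  have p1 := pi_gt0 R.
  rewrite -(@ler_pXn2r _ 2) ?nnegrE ?mulr_ge0 ?addr_ge0 ?sqrtr_ge0 ?mulr_ge0 //.
  rewrite exprMn sqr_sqrtr; last by rewrite addr_ge0 ?divr_ge0 ?sqr_ge0.
  have {}DE : D ^+ 2 = `|t - s| ^+ 2 + (2 * S * sin (th / 2)) ^+ 2.
    by rewrite real_normK ?num_real // DE !exprMn SE; ring.
  have h : S * th <= pi / 2 * (2 * S * sin (th / 2)).
    have -> : pi / 2 * (2 * S * sin (th / 2)) = S * (pi * sin (th / 2)) by field.
    by apply: ler_wpM2l => //; lra.
  (* With [A] = 2 S sin(th/2) and [B] = |t - s|, D^2 = A^2 + B^2, and S th <= (pi/2) A by Jordan's
     inequality at th/2. It remains to bound (pi/2) A + 2 B. *)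
  rewrite DE; move: h; move: (2 * S * sin (th / 2)) `|t - s| n0 => A B B0 h.
  have Sth : 0 <= S * th by rewrite mulr_ge0.
  apply: (@le_trans _ _ ((pi / 2 * A + 2 * B) ^+ 2)).
    by rewrite ler_pXn2r ?nnegrE //; lra.
  (* Cauchy-Schwarz *)
  have -> : (pi ^+ 2 / 4 + 4) * (B ^+ 2 + A ^+ 2) =
      (pi / 2 * A + 2 * B) ^+ 2 + (pi / 2 * B - 2 * A) ^+ 2 by field.
  by rewrite lerDl sqr_ge0.
have sum r : r * th <= S / (p * q) * th ->
    r * th + v <= Num.sqrt (pi ^+ 2 / 4 + 4) * (D / (p * q)).
  move=> h; apply: (@le_trans _ _ ((S * th + 2 * `|t - s|) / (p * q))).
    rewrite mulrDl [S * th / _]mulrAC; exact: lerD.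
  by rewrite mulrA ler_pM2r ?invr_gt0.
(* S / (p q) is the geometric mean of s / p^2 and t / q^2 *)
have [h|h] := leP (s / p ^+ 2) (S / (p * q)).
  by left; apply: sum; exact: ler_wpM2r.
right; apply: sum; apply: ler_wpM2r => //.
rewrite leNgt; apply/negP => h2.
have Spq : 0 <= S / (p * q) by rewrite divr_ge0 // ltW.
have := ltr_pM Spq Spq h h2.
have -> : S / (p * q) * (S / (p * q)) = S ^+ 2 / (p * q) ^+ 2 by field; rewrite !gt_eqF.
have -> : s / p ^+ 2 * (t / q ^+ 2) = s * t / (p * q) ^+ 2 by field; rewrite !gt_eqF.
by rewrite SE ltxx.
Qed.

Theorem theorem1p3 (R : realType) (n : nat) (f : R -> R) :
  (2 <= n)%N ->
  (forall t, 0 <= t -> 0 <= f t) ->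
  moderately_increasing f ->
  convex_on_nonneg f ->
  exists c : R, 0 < c /\ c <= Num.sqrt (pi ^+ 2 / 4 + 4) /\ quasiconvex n f c.
Proof.
move=> n2 f0 mi cvx.
have c0 : 0 < Num.sqrt (pi ^+ 2 / 4 + 4 : R).
  by rewrite sqrtr_gt0 ltr_wpDl // divr_ge0 ?sqr_ge0.
exists (Num.sqrt (pi ^+ 2 / 4 + 4)); split=> //; split=> // x y.
rewrite /rhoM; case: ifP => [/eqP xy|/negbT xy].
  (* At distance zero the constant path on the degenerate interval [0, 0] has length 0. *)
  rewrite mule0; apply: ereal_inf_lbound; exists 0, (fun=> x).
  have z0 : enorm (0 : 'rV[R]_n) = 0.
    by rewrite enormE -(scale0r (0 : 'rV[R]_n)) dotvZl mul0r sqrtr0.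
  split=> //; last 2 first.
  - by have := enorm_eq0 xy => /eqP; rewrite subr_eq0 => /eqP.
  - have := @ellM_is_of_increments R n f 0 0 0 (fun=> x) (fun=> fun=> 0) (fun=> 0).
    rewrite subrr; apply=> //.
    move=> a b _ _ _; rewrite !subrr normr0 !mul0r; split=> //.
    by rewrite /rhoM subrr z0 eqxx.
  apply: (@rectifiable_of_lipschitz _ _ _ 0) => //; first exact: cst_continuous.
  by move=> a b _ _ _; rewrite subrr z0 mul0r.
(* If f vanishes at |x| or at |y|, the right-hand side is +oo. *)
case: ifP => [_|/negbT ff]; first by rewrite gt0_muley ?lte_fin // leey.
have [inc _] := mi.
have x0 := enorm_ge0 x; have y0 := enorm_ge0 y.
have fx : 0 < f (enorm x).
  by rewrite lt_neqAle f0 // andbT eq_sym; apply: contra ff => /eqP ->; rewrite mul0r.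
have fy : 0 < f (enorm y).
  by rewrite lt_neqAle f0 // andbT eq_sym; apply: contra ff => /eqP ->; rewrite mulr0.
have [u u1 xE] := exists_unit_direction x (ltnW n2).
have [v v1 yE] := exists_unit_direction y (ltnW n2).
have [e [th [e1 ue thB vE]]] := exists_polar_form n2 u1 v1.
set s := enorm x in x0 fx xE *; set t := enorm y in y0 fy yE *.
have xP : x = polar u e s 0.
  by rewrite /polar cos0 sin0 mulr1 mulr0 scale0r addr0.
have yP : y = polar u e t th.
  by rewrite {1}yE vE scalerDr !scalerA.
(* Both paths keep their radius at least min(s, t), so f is bounded below along them by its positive
   value there. *)
have m0 : 0 <= Num.min s t by rewrite le_min x0.
have fm : 0 < f (Num.min s t) by rewrite /Num.min; case: ifP.
have [G hG] := length_primitive f0 mi cvx m0 fm.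
have f1 : 0 <= f 1 by exact: f0.
have path a c r0 p := @radial_arc_path R n f G u e (f (Num.min s t))
  (4 * f 1 * (f (Num.min s t))^-1 ^+ 3) s t th r0 a c p u1 e1 ue fm.
have th0 : 0 <= th by case/andP: thB.
have path' a c r0 p : [/\ a = 0, c = th, r0 = s & p = th] \/
      [/\ a = `|t - s|, c = 0, r0 = t & p = `|t - s|] ->
    (inf_ellM f x y <= (r0 / f r0 ^+ 2 * th + `|G t - G s|)%:E)%E.
  move=> ac; have [| | |l [g [h1 h2 h3 h4]]] := path a c r0 p _ x0 y0 th0 _ _ ac.
  - by rewrite !mulr_ge0 ?exprn_ge0 ?invr_ge0 // ltW.
  - by move=> z mz; exact: inc.
  - by move=> z w mz zw; have [] := hG z w mz zw.
  apply: ereal_inf_lbound; exists l, g; split=> //; first by rewrite h2 -xP.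
  by rewrite h3 -yP.
have D2 : enorm (x - y) ^+ 2 = (s - t) ^+ 2 + 4 * s * t * sin (th / 2) ^+ 2.
  by rewrite xP yP dist_polar_sqr // sub0r mulNr sinN sqrrN.
have vB : `|G t - G s| <= 2 * `|t - s| / (f s * f t).
  case: (leP s t) => st.
    have [/andP[h _] _ h2] := hG s t ltac:(by rewrite ge_min lexx) st.
    by rewrite !ger0_norm // subr_ge0.
  have [/andP[h _] _ h2] := hG t s ltac:(by rewrite ge_min lexx orbT) (ltW st).
  move/ltW: st => st; rewrite distrC (distrC t) [f s * _]mulrC.
  by rewrite !ger0_norm // subr_ge0.
rewrite -EFinM.
(* Either the arc of radius s followed by the segment, or the segment followed by the arc of radius
   t. *)
have [h|h] := radial_arc_cost x0 y0 thB fx fy (enorm_ge0 (x - y)) D2 vB.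
- by apply: (le_trans (path' 0 th s th _)); [left|rewrite lee_fin].
- by apply: (le_trans (path' `|t - s| 0 t `|t - s| _)); [right|rewrite lee_fin].
Qed.
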